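(* Let $m>0$ be an integer, $n=2m$, and let $i,j$ be positive integers with $i\neq j$ and $u\in\mathbb{Z}$. Put \[ d_1=2^{i-1}-2^{j-1}+u(2^{m}+1),\quad d_2=2^{i-1}+2^{j-1}+(u-2^{j-1})(2^{m}+1),\quad d_3=-(2^{i-1}+2^{j-1})+(u+2^{i-1})(2^{m}+1). \] Suppose $\gcd(d_1,2^{2m}-1)=1$ and $\gcd(2^{i}-2^{j},2^{m}+1)=1$. Then $x^{d_1}+x^{d_2}+x^{d_3}$ is a permutation polynomial over $\mathbb{F}_{2^{n}}$.
   Context: $\mathbb{F}_{2^n}$ is the finite field with $2^n$ elements. A polynomial is a permutation polynomial over $\mathbb{F}_{2^n}$ if the map $\alpha\mapsto f(\alpha)$ is a bijection of $\mathbb{F}_{2^n}$. Exponents are integers that may be negative; a monomial $x^{d}$ with $d\in\mathbb{Z}$ is interpreted as $x^{d'}$ where $d'$ is the least positive integer congruent to $d$ modulo $2^{n}-1$ (so it is a map on $\mathbb{F}_{2^n}$ sending $0$ to $0$). *)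

(* Defs.v *)
From mathcomp Require Import all_boot all_order all_algebra.
Set Implicit Arguments.
Unset Strict Implicit.
Unset Printing Implicit Defensive.
Import Order.TTheory GRing.Theory Num.Theory.
Local Open Scope ring_scope.

(* The least positive integer congruent to d modulo N, for N > 0: the
   representative of d in {1, ..., N} (so N itself, not 0, when N %| d). *)
Definition least_pos_res (N : nat) (d : int) : nat :=
  `|((d - 1) %% N%:Z)%Z|%N.+1.

Lemma least_pos_resP (N : nat) (d : int) : (0 < N)%N ->
  [/\ (0 < least_pos_res N d)%N,
      ((least_pos_res N d)%:Z = d %[mod N%:Z])%Z &
      forall k : nat, (0 < k)%N -> (k%:Z = d %[mod N%:Z])%Z ->
        (least_pos_res N d <= k)%N].
Proof.
move=> N_gt0; have N_neq0 : N%:Z != 0 by rewrite eqz_nat -lt0n.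
have absE : (`|((d - 1) %% N%:Z)%Z|%N)%:Z = ((d - 1) %% N%:Z)%Z.
  by rewrite gez0_abs // modz_ge0.
split=> // [|[//|k] _ kd]; rewrite /least_pos_res.
  by rewrite -addn1 PoszD absE modzDml subrK.
rewrite ltnS -lez_nat absE.
have -> : ((d - 1) %% N%:Z)%Z = (k%:Z %% N%:Z)%Z.
  by rewrite -modzDml -kd modzDml -addn1 PoszD addrK.
by rewrite modz_nat lez_nat leq_mod.
Qed.

(* The monomial x^d, with d in Z, over the field with 2 ^ n elements. *)
Definition zmonomial (F : finFieldType) (n : nat) (d : int) : {poly F} :=
  'X^(least_pos_res (2 ^ n - 1) d).

Definition permutation_polynomial (F : finFieldType) (p : {poly F}) : Prop :=
  bijective (fun a : F => p.[a]).

(* Main.v *)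
(* Write x' = x^q with q = 2^m, a = 2^(i-1), b = 2^(j-1) and N = x x'.  For
   x <> 0 the trinomial is f(x) = N^(u-b) h with
     h = x^a x'^b + x^a x^b + x'^a x'^b,
   and N^(u-b) lies in F_q.  The point is that for a primitive cube root of
   unity t the form h + t h' splits as t^2 (x^a + t^2 x'^a) (x^b + t x'^b), and
   each factor is an a-th or b-th power of one of the linear forms
   P(x) = x + t x', P'(x) = x + t^2 x'.  If f(x) = f(y), comparing f + t f' and
   f + t^2 f' at x and y gives, for X = P(x)P'(y) and Y = P'(x)P(y), either
   (X/Y)^(a-b) = 1 or (X/Y)^(a+b) = 1, according to the parity of i - j.  As
   X/Y lies in F_q or in the group of (q+1)-th roots of unity, according to the
   parity of m, the coprimality of 2^i - 2^j and q + 1 forces X = Y, that is,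
   y = l x with l in F_q.  Then f(y) = l^d1 f(x), so l^d1 = 1 and
   l = 1. *)
Require Import Defs.
From mathcomp Require Import all_boot all_order all_algebra.
From mathcomp Require Import all_fingroup all_solvable all_field ring.
Set Implicit Arguments.
Unset Strict Implicit.
Unset Printing Implicit Defensive.
Import Order.TTheory GRing.Theory Num.Theory.
Local Open Scope ring_scope.

(** * Integer exponents and Frobenius powers in characteristic 2 *)

Lemma horner_zmonomial (F : finFieldType) (n : nat) (d : int) (x : F) :
  #|F| = (2 ^ n)%N -> (0 < n)%N -> x != 0 -> (zmonomial F n d).[x] = x ^ d.
Proof.
move=> hF n_gt0 x0; rewrite /zmonomial hornerXn.
have N_gt0 : (0 < 2 ^ n - 1)%N by rewrite subn_gt0 -{1}(expn0 2) ltn_exp2l.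
have xN : x ^ (2 ^ n - 1)%N%:Z = 1.
  apply: (mulfI x0); rewrite mulr1 -exprnP -exprS subn1 prednK ?expn_gt0 //.
  by rewrite -hF expf_card.
have xmod (e : int) : x ^ e = x ^ (e %% (2 ^ n - 1)%N%:Z)%Z.
  rewrite {1}(divz_eq e (2 ^ n - 1)%N%:Z) expfzDr //.
  by rewrite (mulrC (e %/ _)%Z) -exprz_exp xN exp1rz mul1r.
have [_ dE _] := @least_pos_resP (2 ^ n - 1) d N_gt0.
by rewrite exprnP (xmod _) dE -xmod.
Qed.

Lemma horner_zmonomial0 (F : finFieldType) (n : nat) (d : int) :
  (zmonomial F n d).[0] = 0.
Proof. by rewrite /zmonomial hornerXn expr0n. Qed.

Lemma frobeniusD (F : fieldType) (c2 : 2%N \in [pchar F]) (k : nat) (x y : F) :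
  (x + y) ^+ (2 ^ k) = x ^+ (2 ^ k) + y ^+ (2 ^ k).
Proof. by apply: exprDn_pchar; rewrite pnatX pnatE // c2. Qed.

Lemma addr_eq0_pchar2 (F : fieldType) (c2 : 2%N \in [pchar F]) (x y : F) :
  x + y = 0 -> x = y.
Proof. by move/eqP; rewrite addr_eq0 oppr_pchar2 // => /eqP. Qed.

Lemma frobenius_inj (F : fieldType) (c2 : 2%N \in [pchar F]) (k : nat) (x y : F) :
  x ^+ (2 ^ k) = y ^+ (2 ^ k) -> x = y.
Proof.
move=> xy; apply: addr_eq0_pchar2 => //; apply/eqP.
suff: (x + y) ^+ (2 ^ k) == 0 by rewrite expf_eq0 => /andP[].
by rewrite frobeniusD // xy addrr_pchar2.
Qed.

Lemma expz_coprime_eq1 (F : fieldType) (x : F) (d e : int) :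
  x != 0 -> gcdz d e = 1 -> x ^ d = 1 -> x ^ e = 1 -> x = 1.
Proof.
move=> x0 de xd xe; have [u [v uv]] := Bezoutz d e.
rewrite -[x]expr1z -de -uv expfzDr // mulrC (mulrC u) (mulrC v) -!exprz_exp.
by rewrite xd xe !exp1rz mulr1.
Qed.

Lemma frobenius_iter (F : fieldType) (x : F) (r k : nat) (e : int) :
  x ^+ (2 ^ r) = x ^ e -> x ^+ (2 ^ (r * k)) = x ^ (e ^+ k).
Proof.
move=> xe; elim: k => [|k IHk]; first by rewrite muln0 expr0 expr1z.
rewrite mulnS expnD mulnC exprM IHk exprS -[in RHS]exprz_exp -xe !exprnP.
by rewrite !exprz_exp mulrC.
Qed.

(* With [r = |i - j|] odd, [x ^+ 2 ^ r = x^-1]; computing [x ^+ 2 ^ (r * m)] in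
   two ways gives [x = x^-1]. *)
Lemma frobenius_odd_fixed (F : fieldType) (c2 : 2%N \in [pchar F])
    (m i j : nat) (x : F) :
  odd (i + j) -> x ^+ (2 ^ i) * x ^+ (2 ^ j) = 1 ->
  x ^+ (2 ^ m) = x ^ ((-1) ^+ m.+1) -> x = 1.
Proof.
wlog le_ij : i j / (i <= j)%N => [IH|].
  have [/IH//|/ltnW ji] := leqP i j.
  by rewrite addnC mulrC; apply: IH.
rewrite -(subnKC le_ij); move: (j - i)%N => r {j le_ij}.
rewrite addnA oddD addnn odd_double /= => r_odd.
rewrite expnD mulnC exprM -exprMn => xri xm.
have xr : x * x ^+ (2 ^ r) = 1.
  by apply: (frobenius_inj c2 (k := i)); rewrite xri expr1n.
have x0 : x != 0.
  by apply: contra_eq_neq xr => ->; rewrite mul0r eq_sym oner_eq0.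
have xr' : x ^+ (2 ^ r) = x ^ (-1) by rewrite exprN1 (mulr1_eq xr).
(* As r is odd, the two values are x^(-e) and x^e with e = (-1)^m; hence x^(2e) = 1, and squaring is
   injective. *)
have := frobenius_iter m xr'; rewrite mulnC (frobenius_iter r xm).
rewrite -exprM mulnC exprM -[in LHS](signr_odd _ r) r_odd expr1 exprS mulN1r.
move=> /(congr1 (fun y => y * x ^ ((-1) ^+ m))); rewrite -!expfzDr // addNr expr0z.
rewrite -mulr2n -mulr_natr -exprz_exp => /esym x2.
have : x ^ ((-1) ^+ m) = 1.
  by apply: (@frobenius_inj _ c2 1); rewrite expr1n -[RHS]x2 exprnP.
rewrite -signr_odd; case: odd; last by rewrite expr0 expr1z.
by rewrite expr1 exprN1 => /eqP; rewrite invr_eq1 => /eqP.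
Qed.

(** * Primitive cube roots of unity *)

Lemma cube_root_unity_exists (F : finFieldType) (m : nat) :
  #|F| = (2 ^ (2 * m))%N -> exists2 t : F, t != 0 & t ^+ 2 + t + 1 = 0.
Proof.
move=> hF.
(* The unit group has order 4^m - 1, a multiple of 3, so Cauchy's theorem yields an element of order
   3. *)
have d3 : (3 %| #|[set: {unit F}]|)%N.
  rewrite card_finField_unit hF expnM -subn1.
  by rewrite -eqn_mod_dvd ?expn_gt0 // -modnXm exp1n.
have [g _ og] := Cauchy (isT : prime 3) d3.
have g3 : FinRing.uval g ^+ 3 = 1.
  by rewrite -FinRing.val_unitX -og expg_order.
exists (FinRing.uval g); first by rewrite -unitfE; exact: valP.
have : (FinRing.uval g - 1) * (FinRing.uval g ^+ 2 + FinRing.uval g + 1) = 0.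
  by transitivity (FinRing.uval g ^+ 3 - 1); [ring | rewrite g3 subrr].
move/eqP; rewrite mulf_eq0 => /orP[|/eqP//]; rewrite subr_eq0 => /eqP g1.
by have : g = 1%g by [apply: val_inj]; move=> g1'; rewrite g1' order1 in og.
Qed.

Lemma expr3_cube_root_unity (F : fieldType) (t : F) :
  t ^+ 2 + t + 1 = 0 -> t ^+ 3 = 1.
Proof.
move=> tE; apply/eqP; rewrite -subr_eq0; apply/eqP.
by transitivity ((t - 1) * (t ^+ 2 + t + 1)); [ring | rewrite tE mulr0].
Qed.

Lemma expr4_cube_root_unity (F : fieldType) (t : F) :
  t ^+ 2 + t + 1 = 0 -> t ^+ 4 = t.
Proof. by move=> tE; rewrite exprS expr3_cube_root_unity // mulr1. Qed.

Lemma sqr_cube_root_unity (F : fieldType) (t : F) :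
  t ^+ 2 + t + 1 = 0 -> (t ^+ 2) ^+ 2 + t ^+ 2 + 1 = 0.
Proof. by move=> tE; rewrite -exprM expr4_cube_root_unity // -[RHS]tE; ring. Qed.

(** Squaring exchanges the two primitive cube roots [t] and [t ^+ 2]; the parity distinctions below
    come from this. *)
Lemma frobenius_cube_root_unity (F : fieldType) (t : F) (k : nat) :
  t ^+ 2 + t + 1 = 0 -> t ^+ (2 ^ k) = if odd k then t ^+ 2 else t.
Proof.
move=> tE; elim: k => [|k IHk]; first by rewrite expr1.
rewrite expnSr exprM {}IHk /=; case: odd => //=.
by rewrite -exprM expr4_cube_root_unity.
Qed.

(** * Use of the coprimality with 2^m + 1 *)

Lemma coprime_frobenius_eq1 (F : fieldType) (m i j : nat) (z : F) :
  gcdz (2 ^+ i.+1 - 2 ^+ j.+1) (2 ^+ m + 1) = 1 ->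
  z != 0 -> z ^+ (2 ^ i) = z ^+ (2 ^ j) -> z ^+ (2 ^ m).+1 = 1 -> z = 1.
Proof.
move=> ij1 z0 zij zm.
have two_pow k : (2 : int) ^+ k = (2 ^ k)%N%:Z by rewrite -natrX natz.
apply: (expz_coprime_eq1 z0 ij1); last by rewrite two_pow -PoszD addn1 -exprnP.
(* Squaring [zij] produces the exponents 2^(i+1) and 2^(j+1); [i] and [j] are one less than in the
   theorem. *)
rewrite !two_pow expfzDr // -invr_expz -!exprnP !expnSr !exprM zij.
by rewrite divff // !expf_neq0.
Qed.

(* For [m] odd, 3 divides [2 ^ m + 1], and it divides [2 ^ i - 2 ^ j] when
   [i] and [j] have the same parity; a cube root of unity detects this. *)
Lemma coprime_same_parity_even (F : fieldType) (c2 : 2%N \in [pchar F])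
    (m i j : nat) (t : F) :
  t != 0 -> t ^+ 2 + t + 1 = 0 ->
  gcdz (2 ^+ i.+1 - 2 ^+ j.+1) (2 ^+ m + 1) = 1 ->
  ~~ odd (i + j) -> ~~ odd m.
Proof.
move=> t0 tE ij1; rewrite oddD negb_add => /eqP ij; apply/negP => m_odd.
have t1 : t = 1.
  apply: coprime_frobenius_eq1 ij1 t0 _ _.
    by rewrite !frobenius_cube_root_unity // ij.
  by rewrite exprS frobenius_cube_root_unity // m_odd -exprS expr3_cube_root_unity.
by move/eqP: tE; rewrite t1 expr1n addrr_pchar2 // add0r oner_eq0.
Qed.

(* [X] and [Y] stand for P(x)P'(y) and P'(x)P(y). *)
Lemma cross_products_eq (F : fieldType) (c2 : 2%N \in [pchar F])
    (m i j : nat) (t X Y : F) :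
  t != 0 -> t ^+ 2 + t + 1 = 0 ->
  gcdz (2 ^+ i.+1 - 2 ^+ j.+1) (2 ^+ m + 1) = 1 ->
  X ^+ (2 ^ m) = (if odd m then X else Y) ->
  Y ^+ (2 ^ m) = (if odd m then Y else X) ->
  (if odd (i + j) then X ^+ (2 ^ i) * X ^+ (2 ^ j) = Y ^+ (2 ^ i) * Y ^+ (2 ^ j)
   else X ^+ (2 ^ i) * Y ^+ (2 ^ j) = Y ^+ (2 ^ i) * X ^+ (2 ^ j)) ->
  X = Y.
Proof.
move=> t0 tE ij1 Xm Ym XY.
have odd_ij := coprime_same_parity_even c2 t0 tE ij1.
(* [X] and [Y] vanish together: by [XY] if i + j is odd, and otherwise because m is even and they
   are conjugate. *)
have XY0 : (X == 0) = (Y == 0).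
  have pow0 z k : (z ^+ (2 ^ k) == 0) = (z == 0 :> F).
    by rewrite expf_eq0 expn_gt0.
  case: (boolP (odd (i + j))) XY odd_ij => [_ XY _|_ _ /(_ isT) m_even].
    by rewrite -[X == 0]orbb -{1}(pow0 X i) -(pow0 X j) -mulf_eq0 XY mulf_eq0 !pow0 orbb.
  by rewrite -(pow0 X m) Xm (negPf m_even).
have [Y0|Y0] := eqVneq Y 0; first by move: XY0; rewrite Y0 eqxx => /eqP.
have X0 : X != 0 by rewrite XY0.
have XdY0 : X / Y != 0 by rewrite mulf_neq0 ?invr_eq0.
apply: divr1_eq; case: (boolP (odd (i + j))) XY odd_ij => [ij XY _|_ XY /(_ isT) m_even].
  apply: (@frobenius_odd_fixed _ c2 m i j) => //.
    by rewrite !expr_div_n mulf_div XY divff // mulf_neq0 ?expf_neq0.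
  rewrite expr_div_n Xm Ym exprS -signr_odd; case: odd.
    by rewrite expr1 mulN1r opprK expr1z.
  by rewrite expr0 mulr1 exprN1 invf_div.
apply: coprime_frobenius_eq1 ij1 XdY0 _ _.
  rewrite !expr_div_n; apply/eqP; rewrite eqr_div ?expf_neq0 //; apply/eqP.
  by rewrite XY mulrC.
rewrite exprS expr_div_n Xm Ym (negPf m_even).
by rewrite mulf_div (mulrC X) divff // mulf_neq0.
Qed.

(** * Splitting into the linear forms P and P' *)

Lemma add_conj_trinomial (F : fieldType) (c2 : 2%N \in [pchar F])
    (m i j : nat) (t x c : F) :
  let x' := x ^+ (2 ^ m) in
  let f := c * (x ^+ (2 ^ i) * x' ^+ (2 ^ j) + x ^+ (2 ^ i) * x ^+ (2 ^ j)
                + x' ^+ (2 ^ i) * x' ^+ (2 ^ j)) in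
  t ^+ 2 + t + 1 = 0 -> x' ^+ (2 ^ m) = x -> c ^+ (2 ^ m) = c ->
  f + t * f ^+ (2 ^ m) =
  c * t ^+ 2 * (x + (if odd i then t else t ^+ 2) * x') ^+ (2 ^ i)
             * (x + (if odd j then t ^+ 2 else t) * x') ^+ (2 ^ j).
Proof.
move=> x' f tE x'm cm.
(* A coefficient enters the 2^k-th power as its own 2^k-th root, which is [s] or [s ^+ 2] by the
   parity of k. *)
have powD (s y : F) k : s ^+ 2 + s + 1 = 0 ->
    y ^+ (2 ^ k) + s * (y ^+ (2 ^ m)) ^+ (2 ^ k) =
    (y + (if odd k then s ^+ 2 else s) * y ^+ (2 ^ m)) ^+ (2 ^ k).
  move=> sE; rewrite frobeniusD // exprMn; congr (_ + _ * _).
  case: ifP => k_odd; last by rewrite frobenius_cube_root_unity // k_odd.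
  rewrite frobenius_cube_root_unity ?k_odd; last exact: sqr_cube_root_unity.
  by rewrite -exprM expr4_cube_root_unity.
have t2E := sqr_cube_root_unity tE.
have := powD _ x i t2E; rewrite -/x' -(exprM t) expr4_cube_root_unity // => <-.
rewrite -(powD _ x j tE) -/x'.
have -> : f ^+ (2 ^ m) = c * (x' ^+ (2 ^ i) * x ^+ (2 ^ j)
    + x' ^+ (2 ^ i) * x' ^+ (2 ^ j) + x ^+ (2 ^ i) * x ^+ (2 ^ j)).
  rewrite /f exprMn cm !frobeniusD // !exprMn.
  by rewrite !(exprAC _ (2 ^ i)) !(exprAC _ (2 ^ j)) x'm -/x'.
rewrite {}/f.
move: (x ^+ (2 ^ i)) (x ^+ (2 ^ j)) (x' ^+ (2 ^ i)) (x' ^+ (2 ^ j)) => a b a' b'.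
have two0 : 2 = 0 :> F := pcharf0 c2.
apply/eqP; rewrite -subr_eq0; apply/eqP.
(* The difference lies in the ideal generated by t^2 + t + 1 and 2; explicit cofactors let [ring]
   check this. *)
transitivity (- c * ((t ^+ 2 + t + 1)
    * (a * b + (t - 1) * (a * b' + t * (a' * b)) + (t ^+ 2 * (t - 1) + 1) * (a' * b'))
    - 2 * (t + 1) * (a * b + a' * b'))); first ring.
by rewrite tE two0 !mul0r subr0 mulr0.
Qed.

(** Conjugation gives x' + t^q x with q = 2^m; taking out t^q leaves P(x) for m odd and P'(x) for m
    even. *)
Lemma conj_linear_form (F : fieldType) (c2 : 2%N \in [pchar F]) (m : nat) (t x : F) :
  let x' := x ^+ (2 ^ m) in
  t ^+ 2 + t + 1 = 0 -> x' ^+ (2 ^ m) = x ->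
  (x + t * x') ^+ (2 ^ m) =
  if odd m then t ^+ 2 * (x + t * x') else t * (x + t ^+ 2 * x').
Proof.
move=> x' tE x'm.
rewrite frobeniusD // exprMn x'm -/x' frobenius_cube_root_unity // addrC.
by case: odd; rewrite mulrDr mulrA -?exprS -?exprSr expr3_cube_root_unity ?mul1r.
Qed.

(** The two products differ by (t^2 - t)(x y' - x' y), and t^2 - t = 1 in characteristic 2. *)
Lemma linear_forms_cross (F : fieldType) (c2 : 2%N \in [pchar F]) (t x x' y y' : F) :
  t ^+ 2 + t + 1 = 0 ->
  (x + t * x') * (y + t ^+ 2 * y') = (x + t ^+ 2 * x') * (y + t * y') ->
  x * y' = x' * y.
Proof.
move=> tE; have two0 : 2 = 0 :> F := pcharf0 c2.
move=> /eqP; rewrite -subr_eq0 => /eqP cross.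
apply/eqP; rewrite -subr_eq0 -oppr_eq0; apply/eqP; rewrite -[RHS]cross.
apply/eqP; rewrite -subr_eq0; apply/eqP.
transitivity ((x * y' - x' * y) * (2 * t - (t ^+ 2 + t + 1))); first ring.
by rewrite tE two0 mul0r subr0 mulr0.
Qed.

(** * Injectivity of the trinomial *)

Theorem theorem3p1 (m n : nat) (hm : (0 < m)%N) (hn : n = (2 * m)%N)
  (F : finFieldType) (hF : #|F| = (2 ^ n)%N)
  (i j : nat) (hi : (0 < i)%N) (hj : (0 < j)%N) (hij : i <> j) (u : int)
  (d1 d2 d3 : int)
  (hd1 : d1 = 2 ^+ (i - 1)%N - 2 ^+ (j - 1)%N + u * (2 ^+ m + 1))
  (hd2 : d2 = 2 ^+ (i - 1)%N + 2 ^+ (j - 1)%N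
              + (u - 2 ^+ (j - 1)%N) * (2 ^+ m + 1))
  (hd3 : d3 = - (2 ^+ (i - 1)%N + 2 ^+ (j - 1)%N)
              + (u + 2 ^+ (i - 1)%N) * (2 ^+ m + 1))
  (hgcd1 : gcdz d1 (2 ^+ (2 * m)%N - 1) = 1)
  (hgcd2 : gcdz (2 ^+ i - 2 ^+ j) (2 ^+ m + 1) = 1) :
  permutation_polynomial
    (zmonomial F n d1 + zmonomial F n d2 + zmonomial F n d3).
Proof.
subst n; have c2 : 2%N \in [pchar F] by exact: card_finPcharP hF isT.
have [t t0 tE] := cube_root_unity_exists hF.
have t2E := sqr_cube_root_unity tE.
(* From here on [i] and [j] are the original indices minus one, so [a] and [b] are 2^i and 2^j. *)
case: i j hi hj hij hd1 hd2 hd3 hgcd2 => [//|i] [//|j] _ _ _.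
rewrite !subSS !subn0; set a : int := 2 ^+ i; set b : int := 2 ^+ j.
set q : int := 2 ^+ m => hd1 hd2 hd3 hgcd2.
have two_pow k : (2 : int) ^+ k = (2 ^ k)%N%:Z by rewrite -natrX natz.
have conjK (x : F) : (x ^+ (2 ^ m)) ^+ (2 ^ m) = x.
  by rewrite -exprM -expnD addnn -mul2n -hF expf_card.
have n_gt0 : (0 < 2 * m)%N by rewrite muln_gt0.
pose f (x : F) := x ^ d1 + x ^ d2 + x ^ d3.
pose c (x : F) := (x * x ^+ (2 ^ m)) ^ (u - b).
pose h (x : F) := x ^+ (2 ^ i) * (x ^+ (2 ^ m)) ^+ (2 ^ j) + x ^+ (2 ^ i) * x ^+ (2 ^ j)
  + (x ^+ (2 ^ m)) ^+ (2 ^ i) * (x ^+ (2 ^ m)) ^+ (2 ^ j).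
pose P (x : F) := x + t * x ^+ (2 ^ m).
pose P' (x : F) := x + t ^+ 2 * x ^+ (2 ^ m).
have c_conj x : c x ^+ (2 ^ m) = c x.
  rewrite /c [LHS]exprnP exprz_exp [_ * (2 ^ m)%N%:Z]mulrC.
  by rewrite -exprz_exp -exprnP exprMn conjK [_ * x]mulrC.
have fE x : x != 0 -> f x = c x * h x.
  move=> x0; rewrite /f /c /h expfzMl !exprnP !exprz_exp.
  rewrite !mulrDr -!mulrA -!expfzDr // -!two_pow -/a -/b -/q.
  (* The exponents d1, d2, d3 are (u - b)(q + 1) plus a + bq, a + b and aq + bq respectively. *)
  by congr (_ + _ + _); congr (x ^ _); rewrite ?hd1 ?hd2 ?hd3; ring.
have c0 x : x != 0 -> c x != 0.
  by move=> x0; rewrite expfz_neq0 // mulf_neq0 // expf_neq0.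
have fE1 x : x != 0 -> f x + t * f x ^+ (2 ^ m) = c x * t ^+ 2 *
    (if odd i then P x else P' x) ^+ (2 ^ i) * (if odd j then P' x else P x) ^+ (2 ^ j).
  move=> x0; rewrite fE // add_conj_trinomial // /P /P'.
  by case: (odd i); case: (odd j).
(* Replacing [t] by [t ^+ 2] exchanges P and P'. *)
have fE2 x : x != 0 -> f x + t ^+ 2 * f x ^+ (2 ^ m) = c x * t *
    (if odd i then P' x else P x) ^+ (2 ^ i) * (if odd j then P x else P' x) ^+ (2 ^ j).
  move=> x0; rewrite fE // add_conj_trinomial // /P /P'.
  rewrite -!(exprM t) (expr4_cube_root_unity tE).
  by case: (odd i); case: (odd j).
have PC x : P x ^+ (2 ^ m) = if odd m then t ^+ 2 * P x else t * P' x.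
  by rewrite /P conj_linear_form.
have P'C x : P' x ^+ (2 ^ m) = if odd m then t * P' x else t ^+ 2 * P x.
  by rewrite /P' conj_linear_form // -!(exprM t) (expr4_cube_root_unity tE).
have even_m := coprime_same_parity_even c2 t0 tE hgcd2.
have f_neq0 x : x != 0 -> f x != 0.
  move=> x0; apply/eqP => fx0.
  have := fE1 x x0; have := fE2 x x0.
  have pow0 (z : F) k : (z ^+ (2 ^ k) == 0) = (z == 0) by rewrite expf_eq0 expn_gt0.
  rewrite fx0 expr0n expn_eq0 /= !mulr0 addr0 => /esym/eqP E2 /esym/eqP E1.
  rewrite !mulf_eq0 !pow0 (negPf (c0 x x0)) (negPf t0) /= in E1 E2.
  (* For i + j odd, [E1] and [E2] give one vanishing each; otherwise m is even and P, P' are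
     conjugate up to a factor. *)
  have [Px P'x] : P x == 0 /\ P' x == 0.
    have P_conj : ~~ odd (i + j) -> (P x == 0) = (P' x == 0).
      move=> /even_m m_even.
      by rewrite -(pow0 (P x) m) PC (negPf m_even) mulf_eq0 (negPf t0).
    move: E1 E2 P_conj; rewrite oddD.
    case: (odd i); case: (odd j) => /=; rewrite ?orbb; try by split.
      by move=> PP' _ /(_ isT) PE; move: PP'; rewrite PE orbb.
    by move=> PP' _ /(_ isT) PE; move: PP'; rewrite PE orbb.
  have : P' x - t * P x = x * (1 - t) by rewrite /P /P'; ring.
  rewrite (eqP Px) (eqP P'x) mulr0 subr0 => /esym/eqP.
  rewrite mulf_eq0 (negPf x0) subr_eq0 eq_sym => /eqP t1.
  by move/eqP: tE; rewrite t1 expr1n addrr_pchar2 // add0r oner_eq0.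
have cross x y : x != 0 -> y != 0 -> f x = f y -> x * y ^+ (2 ^ m) = x ^+ (2 ^ m) * y.
  move=> x0 y0 fxy; apply: (linear_forms_cross c2 tE).
  rewrite -/(P x) -/(P y) -/(P' x) -/(P' y).
  apply: (cross_products_eq c2 t0 tE hgcd2).
  - rewrite exprMn PC P'C; case: odd;
      by rewrite mulrACA -?exprS -?exprSr expr3_cube_root_unity ?mul1r.
  - rewrite exprMn PC P'C; case: odd;
      by rewrite mulrACA -?exprS -?exprSr expr3_cube_root_unity ?mul1r.
  have := fE1 y y0; have := fE2 y y0; rewrite -fxy fE1 // fE2 //.
  move=> E2 E1.
  (* Multiply one splitting at x by the other at y: as f(x) = f(y), exchanging x and y keeps the
     product, and this factor cancels. *)
  have k0 : c x * c y * t ^+ 3 != 0 by rewrite !mulf_neq0 ?c0 ?expf_neq0.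
  move: E1 E2; rewrite oddD !exprMn; case: (odd i); case: (odd j) => /= E1 E2;
    apply: (mulfI k0).
  - transitivity ((c x * t ^+ 2 * P x ^+ (2 ^ i) * P' x ^+ (2 ^ j))
                  * (c y * t * P' y ^+ (2 ^ i) * P y ^+ (2 ^ j))); first ring.
    by rewrite E1 -E2; ring.
  - transitivity ((c x * t ^+ 2 * P x ^+ (2 ^ i) * P x ^+ (2 ^ j))
                  * (c y * t * P' y ^+ (2 ^ i) * P' y ^+ (2 ^ j))); first ring.
    by rewrite E1 -E2; ring.
  - transitivity ((c x * t * P x ^+ (2 ^ i) * P x ^+ (2 ^ j))
                  * (c y * t ^+ 2 * P' y ^+ (2 ^ i) * P' y ^+ (2 ^ j))); first ring.
    by rewrite E2 -E1; ring.
  transitivity ((c x * t * P x ^+ (2 ^ i) * P' x ^+ (2 ^ j))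
                * (c y * t ^+ 2 * P' y ^+ (2 ^ i) * P y ^+ (2 ^ j))); first ring.
  by rewrite E2 -E1; ring.
have f_inj x y : x != 0 -> y != 0 -> f x = f y -> x = y.
  move=> x0 y0 fxy; have := cross x y x0 y0 fxy; move: y0 fxy.
  rewrite -(divfK x0 y); move: (y / x) => l lx0 fxlx xlx.
  have l0 : l != 0 by apply: contraNneq lx0 => ->; rewrite mul0r.
  have lC : l ^+ (2 ^ m) = l.
    have x'x0 : x ^+ (2 ^ m) * x != 0 by rewrite mulf_neq0 ?expf_neq0.
    by apply: (mulIf x'x0); rewrite mulrA -exprMn mulrC xlx; ring.
  have lq : l ^ (q - 1) = 1.
    by rewrite expfzDr // exprN1 /q two_pow -exprnP lC divff.
  have lk k : l ^ (d1 + (q - 1) * k) = l ^ d1.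
    by rewrite expfzDr // -exprz_exp lq exp1rz mulr1.
  (* The three exponents agree modulo q - 1, and l^(q-1) = 1. *)
  have flx : f (l * x) = l ^ d1 * f x.
    have d2E : d2 = d1 + (q - 1) * (- b) by rewrite hd1 hd2; ring.
    have d3E : d3 = d1 + (q - 1) * a by rewrite hd1 hd3; ring.
    by rewrite /f !expfzMl [in l ^ d2]d2E [in l ^ d3]d3E !lk -!mulrDr.
  have ld1 : l ^ d1 = 1.
    by apply: (mulIf (f_neq0 x x0)); rewrite -flx mul1r.
  have lN : l ^ (2 ^+ (2 * m) - 1) = 1.
    by rewrite expfzDr // exprN1 two_pow -exprnP -hF expf_card divff.
  by rewrite (expz_coprime_eq1 l0 hgcd1 ld1 lN) mul1r.
(* The point 0 maps to 0, and by [f_neq0] no other point does. *)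
apply: injF_bij => x y /=; rewrite !hornerD.
have [->|x0] := eqVneq x 0; have [->|y0] := eqVneq y 0 => //;
  rewrite ?horner_zmonomial0 ?(horner_zmonomial _ hF n_gt0) // ?addr0.
- by move=> /esym/eqP fy; have := f_neq0 y y0; rewrite /f fy.
- by move=> /eqP fx; have := f_neq0 x x0; rewrite /f fx.
exact: f_inj.
Qed.
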